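(* Let $\lambda(p,\lambda^1,\dots,\lambda^n)$ be the function associated with an $n$-component reduction $\lambda^i_t=v^i(\lambda^1,\dots,\lambda^n)\lambda^i_x$ of the Benney chain, let $\varphi_1,\dots,\varphi_n$ be arbitrary (analytic) functions of one variable, and let $g_\varphi$ be the associated diagonal metric with contravariant components $g_\varphi^{ii}=\varphi_i(\lambda^i)\,\lambda''(v^i)$. Then the following quadratic expansion holds for all $i,j=1,\dots,n$: $$g_\varphi^{ii}\,\delta^{ij}=\varphi_i(\lambda^i)\,\lambda''(v^i)\,\delta^{ij}=\frac{1}{2\pi \sqrt{-1}}\sum_{k=1}^n\int_{C_k}W_i(\lambda)\,W_j(\lambda)\,\varphi_k(\lambda)\,d\lambda,$$ where $$W_i(\lambda)=W_i(\lambda,\lambda^1,\dots,\lambda^n)=\frac{1}{p(\lambda)-v^i}$$ are the generating functions of the symmetries and $C_k$ is the image, under the analytic continuation of the map $p\mapsto\lambda(p)$, of a sufficiently small closed contour around the point $p=v^k$ in the $p$-plane.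
   Context: The Benney chain is the system $A^k_t=A^{k+1}_x+kA^{k-1}A^0_x$, $k=0,1,2,\dots$, for the moments $A^k(x,t)$. With the (formal) series $\lambda=p+\sum_{k\ge0}A^k/p^{k+1}$ it is equivalent to $\lambda_t=p\lambda_x-A^0_x\lambda_p$. A reduction is a restriction of the chain to the case in which all moments are functions of finitely many variables; every reduction can be put in diagonal form $\lambda^i_t=v^i(\lambda^1,\dots,\lambda^n)\lambda^i_x$, $i=1,\dots,n$ (with distinct $v^i$). For a reduction, $\lambda$ is regarded as (the asymptotic expansion at $p=\infty$ of) an analytic function $\lambda(p,\lambda^1,\dots,\lambda^n)$, which satisfies the Loewner equations $\frac{\partial\lambda}{\partial\lambda^j}=\frac{\partial_jA^0}{p-v^j}\frac{\partial\lambda}{\partial p}$, $\partial_j=\partial/\partial\lambda^j$. The characteristic velocities $v^i$ are the critical points of $\lambda$ in $p$ and the Riemann invariants $\lambda^i$ the critical values: $\frac{\partial\lambda}{\partial p}(v^i)=0$, $\lambda(v^i)=\lambda^i$; $\lambda(p)$ is (continued to be) analytic near $p=v^i$. Write $\lambda''(v^i)=\frac{\partial^2\lambda}{\partial p^2}\big|_{p=v^i}$. $p(\lambda)$ denotes the inverse of $\lambda(p)$ with respect to $p$; on $C_k$ the branch is the one corresponding to the small contour around $v^k$, so that integrals over $C_k$ are computed by the substitution $\lambda=\lambda(p)$, $d\lambda=\lambda_p\,dp$ along that positively oriented contour (which encloses no other $v^l$). The function $\varphi_k$ is analytic near $\lambda=\lambda^k$. The coefficients of the expansion of $W_i(\lambda)$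 at $\lambda=\infty$ are characteristic velocities of symmetries of the reduction. The diagonal metrics associated with the reduction, i.e. the solutions of $\partial_j\ln\sqrt{g_{ii}}=\frac{\partial_jv^i}{v^j-v^i}$, $i\neq j$, are those with contravariant components $g_\varphi^{ii}=\varphi_i(\lambda^i)\lambda''(v^i)$. *)

(* Defs.v *)
From mathcomp Require Import all_boot.
From Stdlib Require Import Reals.
From Coquelicot Require Import Coquelicot.

Set Implicit Arguments.
Unset Strict Implicit.
Unset Printing Implicit Defensive.

Local Open Scope R_scope.
Local Open Scope C_scope.

(* The analysis is that of Coquelicot (complex numbers C, derivatives,
   Riemann integrals); MathComp supplies the finite index types and sums.
   Points of C^I are functions I -> C. *)

(** Analytic functions of one and several complex variables *)

Definition analytic_at (f : C -> C) (z : C) : Prop :=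
  exists (a : nat -> C) (r : R), (0 < r)%R /\
    forall h : C, (Cmod h < r)%R ->
      @is_pseries C_AbsRing C_NormedModule a h (f (z + h)).

Definition Cpower (z : C) (k : nat) : C := @pow_n C_Ring z k.

Definition mterm (I : finType) (c : {ffun I -> nat} -> C) (h : I -> C)
    (N : nat) (a : {ffun I -> 'I_N.+1}) : C :=
  c [ffun i => nat_of_ord (a i)] * \big[Cmult/RtoC 1]_(i : I) Cpower (h i) (a i).

(* f is near z the sum of an absolutely convergent multiple power series;
   the sums range over the multi-indices with all entries at most N. *)
Definition manalytic_at (I : finType) (f : (I -> C) -> C) (z : I -> C) : Prop :=
  exists (c : {ffun I -> nat} -> C) (r : R), (0 < r)%R /\
    forall h : I -> C, (forall i, Cmod (h i) < r)%R ->
      (exists M : R, forall N : nat,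
          (\big[Rplus/0%R]_(a : {ffun I -> 'I_N.+1}) Cmod (mterm c h a) <= M)%R)
      /\ filterlim
           (fun N : nat =>
              \big[Cplus/RtoC 0]_(a : {ffun I -> 'I_N.+1}) mterm c h a)
           eventually (locally (f (fun i => z i + h i))).

Definition mopen (I : finType) (D : (I -> C) -> Prop) : Prop :=
  forall z, D z -> exists r : R, (0 < r)%R /\
    forall w : I -> C, (forall i, Cmod (w i - z i) < r)%R -> D w.

Definition partial (I : finType) (f : (I -> C) -> C) (j : I) (u : I -> C) : C :=
  C_derive (fun s : C => f [eta u with j |-> s]) (u j).

(* Functions and sets of a pair (p, u) in C x C^n, seen on C^(option 'I_n):
   the coordinate None is p. *)
Definition joint (n : nat) (T : Type) (f : C -> ('I_n -> C) -> T)
    (z : option 'I_n -> C) : T :=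
  f (z None) (fun i => z (Some i)).

Definition joint_point (n : nat) (p : C) (u : 'I_n -> C) (o : option 'I_n) : C :=
  if o is Some i then u i else p.

Definition connected_set (D : C -> Prop) : Prop :=
  forall V W : C -> Prop, open V -> open W ->
    (forall p, D p -> V p \/ W p) ->
    (forall p, D p -> V p -> W p -> False) ->
    (forall p, D p -> V p) \/ (forall p, D p -> W p).

(** The Benney chain and its reductions *)

(* For k = 0 the term k A^(k-1) A^0_x vanishes, whatever A 0.-1 is. *)
Definition solves_benney_chain (D : R * R -> Prop) (A : nat -> R -> R -> C) : Prop :=
  forall x t : R, D (x, t) ->
    exists Ax : nat -> C, forall k : nat,
      @is_derive R_AbsRing C_R_NormedModule (fun y => A k y t) x (Ax k)
      /\ @is_derive R_AbsRing C_R_NormedModule (fun s => A k x s) t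
           (Ax k.+1 + RtoC (INR k) * A k.-1 x t * Ax 0%nat).

(* C^1 solutions on D, with values in U, of r^i_t = v^i(r) r^i_x. *)
Definition solves_diagonal (n : nat) (U : ('I_n -> C) -> Prop)
    (v : 'I_n -> ('I_n -> C) -> C) (D : R * R -> Prop)
    (r : R -> R -> 'I_n -> C) : Prop :=
  open D /\
  exists rx rt : 'I_n -> R * R -> C,
    forall x t : R, D (x, t) -> U (r x t) /\
      forall i : 'I_n,
        [/\ @is_derive R_AbsRing C_R_NormedModule (fun y => r y t i) x (rx i (x, t)),
            @is_derive R_AbsRing C_R_NormedModule (fun s => r x s i) t (rt i (x, t)),
            continuous (rx i) (x, t),
            continuous (rt i) (x, t)
          & rt i (x, t) = v i (r x t) * rx i (x, t)].

Record benney_reduction (n : nat) (U : ('I_n -> C) -> Prop)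
    (A : nat -> ('I_n -> C) -> C) (v : 'I_n -> ('I_n -> C) -> C) : Prop :=
  BenneyReduction {
    red_open : mopen U;
    red_moments : forall k u, U u -> manalytic_at (A k) u;
    red_velocities : forall i u, U u -> manalytic_at (v i) u;
    red_distinct : forall u, U u -> forall i j, i <> j -> v i u <> v j u;
    red_chain : forall (D : R * R -> Prop) (r : R -> R -> 'I_n -> C),
      solves_diagonal U v D r ->
      solves_benney_chain D (fun k x t => A k (r x t))
  }.

(* lam, analytic on Dom, is the function lambda(p, u) of the reduction. For
   each u the set of p with Dom p u is connected, so that lam near v^i is the
   analytic continuation of the function which has the expansion
   p + sum_k A^k / p^(k+1) as p tends to infinity in Dom. *)
Record lambda_function (n : nat) (U : ('I_n -> C) -> Prop)
    (A : nat -> ('I_n -> C) -> C) (v : 'I_n -> ('I_n -> C) -> C)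
    (Dom : C -> ('I_n -> C) -> Prop) (lam : C -> ('I_n -> C) -> C) : Prop :=
  LambdaFunction {
    lam_dom_sub : forall p u, Dom p u -> U u;
    lam_dom_open : mopen (joint Dom);
    lam_dom_connected : forall u, U u -> connected_set (fun p => Dom p u);
    lam_dom_unbounded : forall u, U u -> forall M : R,
      exists p, Dom p u /\ (M < Cmod p)%R;
    lam_analytic : forall p u, Dom p u ->
      manalytic_at (joint lam) (joint_point p u);
    lam_expansion : forall u, U u -> forall (N : nat) (eps : R), (0 < eps)%R ->
      exists M : R, forall p, Dom p u -> (M < Cmod p)%R ->
        (Cmod (lam p u
               - (p + \big[Cplus/RtoC 0]_(k < N) (A k u / Cpower p k.+1)%C))
         * Cmod p ^ N <= eps)%R;
    lam_loewner : forall p u j, Dom p u -> p <> v j u ->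
      partial (lam p) j u =
      partial (A 0%nat) j u / (p - v j u) * C_derive (fun q => lam q u) p;
    lam_dom_velocity : forall u i, U u -> Dom (v i u) u;
    lam_critical_point : forall u i, U u -> C_derive (fun q => lam q u) (v i u) = 0;
    lam_critical_value : forall u i, U u -> lam (v i u) u = u i
  }.

Definition lambda'' (n : nat) (lam : C -> ('I_n -> C) -> C) (p : C)
    (u : 'I_n -> C) : C :=
  C_derive (C_derive (fun q => lam q u)) p.

Definition g_contra (n : nat) (lam : C -> ('I_n -> C) -> C)
    (v : 'I_n -> ('I_n -> C) -> C) (phi : 'I_n -> C -> C) (i : 'I_n)
    (u : 'I_n -> C) : C :=
  phi i (u i) * lambda'' lam (v i u) u.

Definition kronecker (n : nat) (i j : 'I_n) : C := if i == j then 1 else 0.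

(* W_i(lambda), as a function of the value p = p(lambda) of the branch. *)
Definition W (n : nat) (v : 'I_n -> ('I_n -> C) -> C) (u : 'I_n -> C)
    (i : 'I_n) (p : C) : C :=
  / (p - v i u).

(** Contours *)

Definition curve_derive (g : R -> C) (t : R) : C :=
  (Derive (fun s => Re (g s)) t, Derive (fun s => Im (g s)) t).

Definition C1_segment (g : R -> C) (a b : R) : Prop :=
  exists h dh : R -> C,
    [/\ forall t, @is_derive R_AbsRing C_R_NormedModule h t (dh t),
        forall t, continuous dh t
      & forall t, (a <= t <= b)%R -> g t = h t].

Inductive piecewise_C1 (g : R -> C) (a : R) : R -> Prop :=
| piecewise_C1_one b : (a < b)%R -> C1_segment g a b -> piecewise_C1 g a b
| piecewise_C1_app b c : piecewise_C1 g a b -> (b < c)%R ->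
    C1_segment g b c -> piecewise_C1 g a c.

(* J is the integral of F(p(l)) dl along the image t |-> f (g t) of the curve
   g : [0, 1] -> C under f, where p(l) is the branch of the inverse of f that
   takes the value g t at the point l = f (g t). The values of the integrand
   at the finitely many corners are irrelevant. *)
Definition is_image_integral (f F : C -> C) (g : R -> C) (J : C) : Prop :=
  @is_RInt C_R_NormedModule
    (fun t => F (g t) * curve_derive (fun s => f (g s)) t) 0 1 J.

(* Closed contours in the punctured disc of radius eps about z that go around z
   once, in the positive sense: the winding number is 1. *)
Definition small_contour (z : C) (eps : R) (g : R -> C) : Prop :=
  [/\ piecewise_C1 g 0 1,
      g 0%R = g 1%R,
      forall t, (0 <= t <= 1)%R -> (0 < Cmod (g t - z) < eps)%R
    & is_image_integral (fun p => p) (fun p => / (p - z)) g (2 * PI * Ci)].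

(* Main.v *)
(* On C_k the substitution lambda = lambda(p) turns the integrand into the form
   lambda'(p) phi_k(lambda(p)) dp / ((p - v^i)(p - v^j)).  Since lambda' vanishes
   at v^k, there is no pole at v^k unless i = j = k, and then the pole is
   simple, with residue phi_k(lambda^k) lambda''(v^k).

   The integrals are evaluated without Cauchy's theory.  We use the functions
   for which |F y - F x - F'(x) (y - x)| <= M |y - x|^2 on a disc: they contain
   the sums of power series, are stable under the algebraic operations and
   composition, and have primitives, given by integration along the segments
   from the centre.  Hence the integrand is c dp / (p - v^k) + dH, where dH does
   not contribute and the first term is the winding number. *)

From HB Require Import structures.
Require Import Defs.
From mathcomp Require Import all_boot.
From Stdlib Require Import Reals Lra FunctionalExtensionality.
From Coquelicot Require Import Coquelicot.

Local Open Scope R_scope.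

(** * Power series *)

Notation Cseries := (@is_series C_AbsRing C_NormedModule).

Lemma Cmod_minus_sym (x y : C) : Cmod (x - y)%C = Cmod (y - x)%C.
Proof. by rewrite -Cmod_opp; congr Cmod; ring. Qed.

Lemma Cmod_minus_le (x y : C) : Cmod (x - y)%C <= Cmod x + Cmod y.
Proof. by rewrite -(Cmod_opp y); apply: Cmod_triangle. Qed.

Lemma Cseries_unique (b : nat -> C) (l1 l2 : C) :
  Cseries b l1 -> Cseries b l2 -> l1 = l2.
Proof.
by move=> h1 h2; exact: (@filterlim_locally_unique nat C_AbsRing C_NormedModule
  eventually _ (sum_n b) l1 l2 h1 h2).
Qed.

Lemma Cseries_bounded (b : nat -> C) (l : C) :
  Cseries b l -> exists K, forall n, Cmod (b n) <= K.
Proof.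
move=> h.
have [M HM] := @filterlim_bounded C_AbsRing C_NormedModule (sum_n b) (ex_intro _ l h).
have {}HM n : Cmod (sum_n b n) <= M by exact: HM.
exists (M + M) => -[|n].
  have := HM 0%nat; rewrite sum_O => h0; have := Cmod_ge_0 (b 0%nat); lra.
have e : b n.+1 = (sum_n b n.+1 - sum_n b n)%C.
  rewrite sum_Sn; change plus with Cplus; ring.
rewrite e; have := Cmod_minus_le (sum_n b n.+1) (sum_n b n).
have := HM n; have := HM n.+1; lra.
Qed.

(** This is the common majorant: power series are evaluated only within half of a radius at which
    their coefficients are controlled. *)
Lemma is_series_half (K : R) :
  is_series (fun n => K * (/ 2) ^ n) (2 * K).
Proof.
have h : is_series (fun n => (/ 2) ^ n) (/ (1 - / 2)).
  by apply: is_series_geom; rewrite Rabs_pos_eq; lra.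
have := @is_series_scal R_AbsRing R_NormedModule K _ _ h.
by congr is_series; rewrite /scal /= /mult /=; field.
Qed.

Lemma Cseries_half (b : nat -> C) (K : R) :
  (forall n, Cmod (b n) <= K * (/ 2) ^ n) -> exists l, Cseries b l.
Proof.
move=> h; apply: (@ex_series_le C_AbsRing C_CompleteNormedModule b
  (fun n => K * (/ 2) ^ n)).
  exact: h.
by exists (2 * K); apply: is_series_half.
Qed.

Lemma Cseries_half_le (b : nat -> C) (K : R) (l : C) :
  (forall n, Cmod (b n) <= K * (/ 2) ^ n) -> Cseries b l -> Cmod l <= 2 * K.
Proof.
move=> hb hl.
have h1 : filterlim (fun n => norm (sum_n b n)) eventually (locally (norm l)).
  apply: filterlim_comp; first exact: hl.
  exact: (@filterlim_norm C_AbsRing C_NormedModule).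
have h2 := is_series_half K.
have := @filterlim_le nat eventually _ _ _ (norm l) (2 * K) _ h1 h2.
apply.
exists 0%nat => n _.
apply: Rle_trans; first exact: (@norm_sum_n_m C_AbsRing C_NormedModule).
by apply: sum_n_m_le => k; exact: hb.
Qed.

Definition powser (a : nat -> C) (h : C) (n : nat) : C := (Cpow h n * a n)%C.

Lemma Cpower_Cpow (h : C) (n : nat) : Cpower h n = Cpow h n.
Proof. by elim: n => [|n IH] //=; rewrite -IH. Qed.

Lemma is_pseries_powser (a : nat -> C) (h l : C) :
  @is_pseries C_AbsRing C_NormedModule a h l <-> Cseries (powser a h) l.
Proof.
by split; apply: is_series_ext => n; rewrite /powser -Cpower_Cpow.
Qed.

(* Junk value where the series diverges. *)
Definition psum (a : nat -> C) (h : C) : C :=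
  @iota C_CompleteNormedModule (Cseries (powser a h)).

Lemma psum_eq (a : nat -> C) (h l : C) : Cseries (powser a h) l -> psum a h = l.
Proof.
move=> hl; apply: (@iota_unique C_AbsRing C_CompleteNormedModule) => // y hy.
exact: Cseries_unique hy hl.
Qed.

(** A Cauchy estimate at radius [rho], used in place of the radius of convergence. It survives a
    shift of the coefficients, and also formal differentiation once [rho] is halved. *)
Definition coef_bound (a : nat -> C) (rho : R) : Prop :=
  exists K, forall n, Cmod (a n) * rho ^ n <= K.

(** These are the coefficients of the difference quotient of the sum at the centre, so a factor
    [p - z] is divided out without creating a singularity. *)
Definition ashift (a : nat -> C) (n : nat) : C := a n.+1.

Definition aderiv (a : nat -> C) (n : nat) : C := (RtoC (INR n.+1) * a n.+1)%C.

Lemma INR_S_le_pow2 (n : nat) : INR n.+1 <= 2 ^ n.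
Proof.
elim: n => [|n IH]; first by rewrite /=; lra.
rewrite S_INR -tech_pow_Rmult; have := pos_INR n.
rewrite S_INR in IH *; lra.
Qed.

Lemma coef_bound_ashift (a : nat -> C) (rho : R) :
  0 < rho -> coef_bound a rho -> coef_bound (ashift a) rho.
Proof.
move=> hr [K hK]; exists (K / rho) => n; have := hK n.+1.
rewrite /ashift -tech_pow_Rmult => h.
apply: (Rmult_le_reg_r rho) => //.
have -> : K / rho * rho = K by field; lra.
lra.
Qed.

(** Halving the radius gains [2 ^ n], which absorbs the factor [n + 1] of differentiation. *)
Lemma coef_bound_aderiv (a : nat -> C) (rho : R) :
  0 < rho -> coef_bound a rho -> coef_bound (aderiv a) (rho / 2).
Proof.
move=> hr ha; have [K hK] := coef_bound_ashift a rho hr ha.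
exists K => n; apply: Rle_trans (hK n).
rewrite /aderiv /ashift Cmod_mult Cmod_R Rabs_pos_eq; last exact: pos_INR.
rewrite Rpow_mult_distr pow_inv.
have h2 : 0 < 2 ^ n by apply: pow_lt; lra.
have := INR_S_le_pow2 n => h3.
have -> : INR n.+1 * Cmod (a n.+1) * (rho ^ n * / 2 ^ n)
  = (Cmod (a n.+1) * rho ^ n) * (INR n.+1 * / 2 ^ n) by ring.
rewrite -[X in _ <= X]Rmult_1_r; apply: Rmult_le_compat_l.
  by apply: Rmult_le_pos; [exact: Cmod_ge_0|apply: pow_le; lra].
apply: (Rmult_le_reg_r (2 ^ n)) => //.
by rewrite Rmult_assoc Rinv_l; lra.
Qed.

Lemma powser_le (a : nat -> C) (rho K : R) (h : C) (n : nat) :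
  (forall n, Cmod (a n) * rho ^ n <= K) -> Cmod h <= rho / 2 ->
  Cmod (powser a h n) <= K * (/ 2) ^ n.
Proof.
move=> hK hh; rewrite /powser Cmod_mult Cmod_pow.
have h1 : Cmod h ^ n <= (rho * / 2) ^ n.
  by apply: pow_incr; split; [exact: Cmod_ge_0|].
apply: Rle_trans (_ : (Cmod (a n) * rho ^ n) * (/ 2) ^ n <= _).
  rewrite Rmult_assoc -Rpow_mult_distr Rmult_comm.
  by apply: Rmult_le_compat_l; [exact: Cmod_ge_0|].
by apply: Rmult_le_compat_r; [apply: pow_le; lra|].
Qed.

Lemma psum_correct (a : nat -> C) (rho : R) (h : C) :
  coef_bound a rho -> Cmod h <= rho / 2 -> Cseries (powser a h) (psum a h).
Proof.
move=> [K hK] hh.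
have [l hl] : exists l, Cseries (powser a h) l.
  by apply: (Cseries_half (powser a h) K) => n; apply: powser_le hK hh.
by rewrite (psum_eq _ _ _ hl).
Qed.

Lemma psum_bound (a : nat -> C) (rho : R) :
  coef_bound a rho ->
  exists K, forall h, Cmod h <= rho / 2 -> Cmod (psum a h) <= K.
Proof.
move=> ha; have [K hK] := ha; exists (2 * K) => h hh.
apply: (Cseries_half_le (powser a h)); last exact: psum_correct ha hh.
by move=> n; apply: powser_le hK hh.
Qed.

Lemma Cseries_shift (b : nat -> C) (l : C) :
  Cseries (fun n => b n.+1) l -> Cseries b (b 0%nat + l)%C.
Proof.
move=> h; apply: (@is_series_decr_1 C_AbsRing C_NormedModule).
have -> : @plus C_NormedModule (b 0%nat + l)%C (opp (b 0%nat)) = l :> C.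
  by change plus with Cplus; change opp with Copp; ring.
exact: h.
Qed.

Lemma Cseries_scal (c : C) (b : nat -> C) (l : C) :
  Cseries b l -> Cseries (fun n => (c * b n)%C) (c * l)%C.
Proof. exact: (@is_series_scal C_AbsRing C_NormedModule). Qed.

Lemma Cseries_minus (b c : nat -> C) (l m : C) :
  Cseries b l -> Cseries c m -> Cseries (fun n => (b n - c n)%C) (l - m)%C.
Proof. exact: (@is_series_minus C_AbsRing C_NormedModule). Qed.

Lemma psum_ashift (a : nat -> C) (rho : R) (h : C) :
  0 < rho -> coef_bound a rho -> Cmod h <= rho / 2 ->
  psum a h = (a 0%nat + h * psum (ashift a) h)%C.
Proof.
move=> hr ha hh; apply: psum_eq.
have -> : a 0%nat = powser a h 0 by rewrite /powser /=; ring.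
apply: Cseries_shift.
have := psum_correct _ _ _ (coef_bound_ashift _ _ hr ha) hh => /(Cseries_scal h).
by apply: is_series_ext => n; rewrite /powser /ashift /=; ring.
Qed.

Lemma psum_0 (a : nat -> C) : psum a 0 = a 0%nat.
Proof.
apply: psum_eq.
have -> : a 0%nat = (powser a 0 0 + 0)%C by rewrite /powser /=; ring.
apply: Cseries_shift.
have : Cseries (fun _ : nat => (RtoC 0 * RtoC 0)%C) (RtoC 0 * RtoC 0)%C.
  apply: Cseries_scal.
  have [l hl] : exists l, Cseries (fun _ : nat => RtoC 0) l.
    by apply: (Cseries_half _ 0) => n; rewrite Cmod_0; lra.
  have l0 : Cmod l <= 2 * 0.
    by apply: Cseries_half_le hl => n; rewrite Cmod_0; lra.
  have := Cmod_ge_0 l => h.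
  have e : l = RtoC 0 by apply: Cmod_eq_0; lra.
  by rewrite e in hl.
rewrite Cmult_0_l; apply: is_series_ext => n; rewrite /powser /=; ring.
Qed.

(* With e_n = y^n - x^n - n x^(n-1) (y - x), one has
   e_(n+1) = y e_n + n x^(n-1) (y - x)^2. *)
Lemma pow_taylor2 (x y : C) (s : R) (n : nat) :
  0 <= s -> Cmod x <= s -> Cmod y <= s ->
  Cmod (Cpow y n.+1 - Cpow x n.+1 - RtoC (INR n.+1) * Cpow x n * (y - x))%C * s
    <= 4 ^ n * s ^ n * Cmod (y - x) ^ 2.
Proof.
move=> hs hx hy.
have hk := pow2_ge_0 (Cmod (y - x)).
elim: n => [|n IH].
  have -> : (Cpow y 1 - Cpow x 1 - RtoC (INR 1) * Cpow x 0 * (y - x))%C = 0%C.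
    by rewrite /=; ring.
  by rewrite Cmod_0 /=; simpl in hk; lra.
set e := (_ - _ - _)%C in IH.
have -> : (Cpow y n.+2 - Cpow x n.+2 - RtoC (INR n.+2) * Cpow x n.+1 * (y - x)
   = y * e + RtoC (INR n.+1) * Cpow x n * ((y - x) * (y - x)))%C.
  rewrite /e (S_INR n.+1) RtoC_plus /=; ring.
have hin := INR_S_le_pow2 n.
have h24 : 2 ^ n <= 4 ^ n by apply: pow_incr; lra.
have h4 : 0 <= 4 ^ n by apply: pow_le; lra.
have hsn : 0 <= s ^ n by apply: pow_le.
have hxn : Cmod x ^ n <= s ^ n by apply: pow_incr; split; [exact: Cmod_ge_0|].
have hxn0 : 0 <= Cmod x ^ n by apply: pow_le; exact: Cmod_ge_0.
apply: Rle_trans (_ : (s * Cmod e + 4 ^ n * s ^ n * Cmod (y - x) ^ 2) * s <= _).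
  apply: Rmult_le_compat_r => //.
  apply: Rle_trans; first exact: Cmod_triangle.
  rewrite !Cmod_mult Cmod_R Rabs_pos_eq ?Cmod_pow; last exact: pos_INR.
  apply: Rplus_le_compat.
    by apply: Rmult_le_compat_r; [exact: Cmod_ge_0|].
  have -> : Cmod (y - x) * Cmod (y - x) = Cmod (y - x) ^ 2 by ring.
  apply: Rmult_le_compat_r => //.
  by apply: Rmult_le_compat => //; [exact: pos_INR|lra].
have -> : (s * Cmod e + 4 ^ n * s ^ n * Cmod (y - x) ^ 2) * s
  = s * (Cmod e * s) + 4 ^ n * s ^ n * Cmod (y - x) ^ 2 * s by ring.
(* The two summands are equal, the second thanks to [n + 1 <= 2 ^ n <= 4 ^ n]; as [2 <= 4], their
   sum stays below the bound for the next exponent. *)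
apply: Rle_trans (_ : s * (4 ^ n * s ^ n * Cmod (y - x) ^ 2)
   + 4 ^ n * s ^ n * Cmod (y - x) ^ 2 * s <= _).
  by apply: Rplus_le_compat_r; apply: Rmult_le_compat_l.
have := Rmult_le_pos _ _ (Rmult_le_pos _ _ h4 hsn) (Rmult_le_pos _ _ hs hk) => hp.
rewrite -!tech_pow_Rmult; nra.
Qed.

(** The estimate is made term by term with [s = rho / 8] in [pow_taylor2]: then [4 ^ n * s ^ n] is
    [rho ^ n] times [(/ 2) ^ n], and the coefficient bound leaves a geometric series. In the
    constant, [2] is the sum of that series and the divisor [rho / 8] is the factor [s] of
    [pow_taylor2]. *)
Lemma psum_taylor2 (a : nat -> C) (rho : R) :
  0 < rho -> coef_bound a rho ->
  exists K, forall x y, Cmod x <= rho / 8 -> Cmod y <= rho / 8 ->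
    Cmod (psum a y - psum a x - psum (aderiv a) x * (y - x))%C
      <= K * Cmod (y - x) ^ 2.
Proof.
move=> hr ha.
have [K hK] := coef_bound_ashift a rho hr ha.
have hd := coef_bound_aderiv a rho hr ha.
exists (2 * (K / (rho / 8))) => x y hx hy.
have hx2 : Cmod x <= rho / 2 by lra.
have hy2 : Cmod y <= rho / 2 by lra.
have hx4 : Cmod x <= rho / 2 / 2 by lra.
(* Once the constant terms cancel, the three series have matching indices, and their n-th terms
   combine into [a n.+1] times a remainder of [pow_taylor2]. *)
rewrite (psum_ashift a rho y) // (psum_ashift a rho x) //.
set X := psum (aderiv a) x.
have -> : (a 0%nat + y * psum (ashift a) y - (a 0%nat + x * psum (ashift a) x)
  - X * (y - x) = y * psum (ashift a) y - x * psum (ashift a) x - (y - x) * X)%C.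
  by ring.
have hs := coef_bound_ashift a rho hr ha.
have s1 := Cseries_scal y _ _ (psum_correct _ _ _ hs hy2).
have s2 := Cseries_scal x _ _ (psum_correct _ _ _ hs hx2).
have s3 := Cseries_scal (y - x)%C _ _ (psum_correct _ _ _ hd hx4).
have := Cseries_minus _ _ _ _ (Cseries_minus _ _ _ _ s1 s2) s3.
have -> : 2 * (K / (rho / 8)) * Cmod (y - x) ^ 2
  = 2 * (K / (rho / 8) * Cmod (y - x) ^ 2) by ring.
apply: Cseries_half_le => n; rewrite /powser /ashift /aderiv.
have -> : (y * (Cpow y n * a n.+1) - x * (Cpow x n * a n.+1)
   - (y - x) * (Cpow x n * (RtoC (INR n.+1) * a n.+1))
   = a n.+1 * (Cpow y n.+1 - Cpow x n.+1 - RtoC (INR n.+1) * Cpow x n * (y - x)))%C.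
  by rewrite /=; ring.
rewrite Cmod_mult.
have hr8 : 0 <= rho / 8 by lra.
have := pow_taylor2 x y (rho / 8) n hr8 hx hy.
set E := Cmod (_ - _ - _)%C => hE.
apply: (Rmult_le_reg_r (rho / 8)); first lra.
rewrite Rmult_assoc.
apply: Rle_trans (_ : Cmod (a n.+1) * (4 ^ n * (rho / 8) ^ n * Cmod (y - x) ^ 2) <= _).
  by apply: Rmult_le_compat_l; [exact: Cmod_ge_0|].
have -> : 4 ^ n * (rho / 8) ^ n = rho ^ n * (/ 2) ^ n.
  by rewrite -!Rpow_mult_distr; congr pow; field.
have -> : K / (rho / 8) * Cmod (y - x) ^ 2 * (/ 2) ^ n * (rho / 8)
  = K * ((/ 2) ^ n * Cmod (y - x) ^ 2) by field; lra.
have -> : Cmod (a n.+1) * (rho ^ n * (/ 2) ^ n * Cmod (y - x) ^ 2)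
  = (Cmod (a n.+1) * rho ^ n) * ((/ 2) ^ n * Cmod (y - x) ^ 2) by ring.
apply: Rmult_le_compat_r; last exact: hK.
by apply: Rmult_le_pos; [apply: pow_le; lra|exact: pow2_ge_0].
Qed.

Lemma analytic_at_psum (f : C -> C) (z : C) :
  analytic_at f z -> exists a rho,
    [/\ 0 < rho, coef_bound a rho &
      forall p, Cmod (p - z) <= rho -> f p = psum a (p - z)].
Proof.
move=> [a [r [hr h]]]; exists a, (r / 2).
have hf p : Cmod (p - z) <= r / 2 -> Cseries (powser a (p - z)) (f p).
  move=> hp; apply/is_pseries_powser.
  have -> : p = (z + (p - z))%C by ring.
  have -> : (z + (p - z) - z = p - z)%C by ring.
  by apply: h; lra.
split; [lra| |by move=> p /hf /psum_eq].
have e : (z + RtoC (r / 2) - z)%C = RtoC (r / 2) by ring.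
have := hf (z + RtoC (r / 2))%C.
rewrite e Cmod_R Rabs_pos_eq; last lra.
move=> /(_ (Rle_refl _)) /Cseries_bounded [K hK]; exists K => n.
have := hK n; rewrite /powser Cmod_mult Cmod_pow Cmod_R Rabs_pos_eq; last lra.
by rewrite Rmult_comm.
Qed.

(** * Functions with a quadratic Taylor estimate *)

Notation CR := C_R_NormedModule.

Lemma norm_CR (z : C) : @norm R_AbsRing CR z = Cmod z.
Proof.
rewrite /Cmod; cbn; rewrite /prod_norm; cbn; rewrite /norm /= /abs /=.
by congr sqrt; rewrite !Rmult_1_r -!Rabs_mult !Rabs_pos_eq //; apply: Rle_0_sqr.
Qed.

Lemma scal_CR (t : R) (z : C) : @scal R_AbsRing CR t z = (RtoC t * z)%C.
Proof.
case: z => a b; rewrite /scal /= /prod_scal /scal /= /mult /= /Cmult /=.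
by congr pair; ring.
Qed.

Lemma locally_Cmod (z : C) (P : C -> Prop) :
  locally z P <-> exists d, 0 < d /\ forall y, Cmod (y - z) < d -> P y.
Proof.
split.
  move=> [d hd]; exists d; split; first exact: cond_pos.
  by move=> y hy; apply: hd; apply: C_NormedModule_mixin_compat1.
move=> [d [d0 hd]].
(* The basic neighbourhoods of [C] are squares, and [sqrt 2] compares them with discs. *)
have s2 : 0 < sqrt 2 by apply: sqrt_lt_R0; lra.
have d2 : 0 < d / sqrt 2 by apply: Rdiv_lt_0_compat.
exists (mkposreal _ d2) => y hy; apply: hd.
have := C_NormedModule_mixin_compat2 _ _ _ hy => /=.
by have -> : sqrt 2 * (d / sqrt 2) = d by field; lra.
Qed.

Lemma Cmod_triangle3 (x y z : C) :
  Cmod (x + y + z)%C <= Cmod x + Cmod y + Cmod z.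
Proof.
have := Cmod_triangle (x + y) z; have := Cmod_triangle x y; lra.
Qed.

(** The pointwise estimate yields both notions of derivative in play: [C_derive] in the plane, and
    the real derivative along a curve. *)
Definition taylor2_at (H : C -> C) (x l : C) : Prop :=
  exists M d, [/\ 0 < d, 0 <= M & forall y, Cmod (y - x) < d ->
    Cmod (H y - H x - l * (y - x)) <= M * Cmod (y - x) ^ 2].

Lemma taylor2_small (H : C -> C) (x l : C) (eps : R) :
  taylor2_at H x l -> 0 < eps ->
  exists d, 0 < d /\ forall y, Cmod (y - x) < d ->
    Cmod (H y - H x - l * (y - x)) <= eps * Cmod (y - x).
Proof.
move=> [M [d [d0 M0 hM]]] e0.
have e1 : 0 < eps / (M + 1) by apply: Rdiv_lt_0_compat; lra.
exists (Rmin d (eps / (M + 1))); split; first exact: Rmin_pos.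
move=> y hy.
have h1 := Rlt_le_trans _ _ _ hy (Rmin_l _ _).
have h2 := Rlt_le_trans _ _ _ hy (Rmin_r _ _).
apply: Rle_trans (hM y h1) _.
have k0 := Cmod_ge_0 (y - x).
have -> : M * Cmod (y - x) ^ 2 = (M * Cmod (y - x)) * Cmod (y - x) by ring.
apply: Rmult_le_compat_r => //.
apply: Rle_trans (_ : (M + 1) * (eps / (M + 1)) <= _); last by apply: Req_le; field; lra.
by apply: Rmult_le_compat; lra.
Qed.

Lemma is_derive_taylor2 (H : C -> C) (g : R -> C) (t : R) (l dg : C) :
  taylor2_at H (g t) l -> @is_derive R_AbsRing CR g t dg ->
  @is_derive R_AbsRing CR (fun s => H (g s)) t (l * dg)%C.
Proof.
move=> hH hg.
(* Seen as a map of real normed spaces, [H] has multiplication by [l] as its differential, so the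
   real chain rule applies. *)
have hd : @filterdiff R_AbsRing CR CR H (locally (g t)) (fun y : C => (l * y)%C).
  split.
    split.
    - by move=> x y; change (l * (x + y) = l * x + l * y)%C; ring.
    - move=> k x; rewrite !scal_CR.
      by change (l * (RtoC k * x) = RtoC k * (l * x))%C; ring.
    - exists (Cmod l + 1); split; first by have := Cmod_ge_0 l; lra.
      move=> x; rewrite !norm_CR Cmod_mult.
      apply: Rmult_le_compat_r; [exact: Cmod_ge_0|lra].
  move=> x hx eps.
  have {hx} -> : x = g t :> C.
    by apply: esym; exact: (@is_filter_lim_locally_unique R_AbsRing CR).
  have [d [d0 hd]] := taylor2_small _ _ _ _ hH (cond_pos eps).
  apply/locally_Cmod; exists d; split => // y hy.
  by rewrite !norm_CR; apply: hd.
have := @filterdiff_comp' R_AbsRing _ CR CR g H t _ _ hg hd.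
move=> hh; apply: (@filterdiff_ext_lin R_AbsRing _ CR _ _ _ _ _ hh) => y.
rewrite !scal_CR.
by change (l * (RtoC y * dg) = RtoC y * (l * dg))%C; ring.
Qed.

Lemma C_derive_taylor2 (H : C -> C) (x l : C) :
  taylor2_at H x l -> C_derive H x = l.
Proof.
move=> hH; apply: is_C_lim_unique => P /locally_Cmod [e [e0 he]].
have e2 : 0 < e / 2 by lra.
have [d [d0 hd]] := taylor2_small _ _ _ _ hH e2.
rewrite /filtermap /locally' /within; apply/locally_Cmod.
exists d; split => // y hy yx; apply: he.
have yx0 : (y - x <> 0)%C by exact: Cminus_eq_contra.
have -> : ((H y - H x) / (y - x) - l = (H y - H x - l * (y - x)) / (y - x))%C.
  by field.
rewrite Cmod_div //; have k0 : 0 < Cmod (y - x) by apply/Cmod_gt_0.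
apply: (Rmult_lt_reg_r (Cmod (y - x))) => //.
have -> : forall u, u / Cmod (y - x) * Cmod (y - x) = u by move=> u; field; lra.
have := hd y hy.
have : 0 < e / 2 * Cmod (y - x) by apply: Rmult_lt_0_compat.
lra.
Qed.

Definition sderiv (z : C) (s : R) (F F' : C -> C) : Prop :=
  exists M, 0 <= M /\ forall x, Cmod (x - z) < s ->
    [/\ Cmod (F x) <= M, Cmod (F' x) <= M &
      forall y, Cmod (y - z) < s ->
        Cmod (F y - F x - F' x * (y - x)) <= M * Cmod (y - x) ^ 2].

Definition holo (z : C) (s : R) (F : C -> C) : Prop := exists F', sderiv z s F F'.

Lemma sderiv_mono (z : C) (s1 s2 : R) (F F' : C -> C) :
  s1 <= s2 -> sderiv z s2 F F' -> sderiv z s1 F F'.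
Proof.
move=> h [M [M0 hM]]; exists M; split => // x hx.
have [|h1 h2 h3] := hM x; first lra.
by split => // y hy; apply: h3; lra.
Qed.

Lemma holo_mono (z : C) (s1 s2 : R) (F : C -> C) :
  s1 <= s2 -> holo z s2 F -> holo z s1 F.
Proof. by move=> h [F' hF]; exists F'; apply: sderiv_mono hF. Qed.

Lemma disc_taylor2 (z x : C) (s M : R) (F F' : C -> C) :
  0 <= M -> Cmod (x - z) < s ->
  (forall y, Cmod (y - z) < s ->
     Cmod (F y - F x - F' x * (y - x)) <= M * Cmod (y - x) ^ 2) ->
  taylor2_at F x (F' x).
Proof.
move=> M0 hx h; exists M, (s - Cmod (x - z)); split => //; first lra.
move=> y hy; apply: h.
have -> : (y - z = (y - x) + (x - z))%C by ring.
by have := Cmod_triangle (y - x) (x - z); lra.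
Qed.

Lemma sderiv_taylor2 (z x : C) (s : R) (F F' : C -> C) :
  sderiv z s F F' -> Cmod (x - z) < s -> taylor2_at F x (F' x).
Proof.
move=> [M [M0 hM]] hx; have [_ _ h3] := hM x hx.
exact: disc_taylor2 M0 hx h3.
Qed.

Lemma disc_diam (z x y : C) (s : R) :
  Cmod (x - z) < s -> Cmod (y - z) < s -> Cmod (y - x) <= 2 * s.
Proof.
move=> hx hy; have -> : (y - x = (y - z) - (x - z))%C by ring.
by have := Cmod_minus_le (y - z) (x - z); lra.
Qed.

(** For [F'], the Taylor remainders taken at [x] and at [y] add up to [(F' y - F' x) * (y - x)], and
    both are quadratic in [y - x]. *)
Lemma sderiv_lipschitz (z : C) (s : R) (F F' : C -> C) :
  sderiv z s F F' -> exists L, 0 <= L /\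
    forall x y, Cmod (x - z) < s -> Cmod (y - z) < s ->
      Cmod (F y - F x) <= L * Cmod (y - x) /\
      Cmod (F' y - F' x) <= L * Cmod (y - x).
Proof.
move=> [M [M0 hM]].
(* One constant serves both estimates: [M + M * (2 * Rabs s)] is for [F], two points of the disc
   being at most [2 * s] apart, and [2 * M] is for [F']. *)
have L0 : 0 <= M + M * (2 * Rabs s) + 2 * M.
  by have := Rabs_pos s; have := Rmult_le_pos M (Rabs s) M0 (Rabs_pos s); lra.
exists (M + M * (2 * Rabs s) + 2 * M); split => // x y hx hy.
have [a1 a2 a3] := hM x hx; have [b1 b2 b3] := hM y hy.
have k0 := Cmod_ge_0 (y - x).
have hd := disc_diam z x y s hx hy.
have s0 := Rle_abs s.
split.
  have -> : (F y - F x = (F y - F x - F' x * (y - x)) + F' x * (y - x))%C by ring.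
  have h1 := Cmod_triangle (F y - F x - F' x * (y - x)) (F' x * (y - x)).
  apply: Rle_trans h1 _.
  rewrite Cmod_mult.
  have h2 := a3 y hy.
  have h3 : Cmod (F' x) * Cmod (y - x) <= M * Cmod (y - x)
    by apply: Rmult_le_compat_r.
  have h4 : M * Cmod (y - x) ^ 2 <= M * (2 * Rabs s) * Cmod (y - x).
    have -> : M * Cmod (y - x) ^ 2 = M * Cmod (y - x) * Cmod (y - x) by ring.
    apply: Rmult_le_compat_r => //; apply: Rmult_le_compat_l => //; lra.
  have h5 := Rmult_le_pos _ _ M0 k0.
  lra.
have [k00|kp] := Req_dec (Cmod (y - x)) 0.
  have -> : y = x by apply/Ceq_minus; apply: Cmod_eq_0.
  have -> : (F' x - F' x = 0)%C by ring.
  by rewrite Cmod_0; apply: Rmult_le_pos => //; exact: Cmod_ge_0.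
have kk : 0 < Cmod (y - x) by lra.
apply: (Rmult_le_reg_r (Cmod (y - x))) => //.
rewrite -Cmod_mult.
have -> : ((F' y - F' x) * (y - x)
  = (F y - F x - F' x * (y - x)) + (F x - F y - F' y * (x - y)))%C by ring.
apply: Rle_trans; first exact: Cmod_triangle.
have h1 := a3 y hy; have h2 := b3 x hx; rewrite (Cmod_minus_sym x y) in h2.
have h5 := Rmult_le_pos _ _ M0 (Rabs_pos s).
have h6 := pow2_ge_0 (Cmod (y - x)).
have -> : (M + M * (2 * Rabs s) + 2 * M) * Cmod (y - x) * Cmod (y - x)
  = (M + 2 * (M * Rabs s) + 2 * M) * Cmod (y - x) ^ 2 by ring.
have h7 : 0 <= (M + 2 * (M * Rabs s)) * Cmod (y - x) ^ 2.
  by apply: Rmult_le_pos; lra.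
lra.
Qed.

Lemma sderiv_const (z c : C) (s : R) : sderiv z s (fun _ => c) (fun _ => 0%C).
Proof.
exists (Cmod c); split; first exact: Cmod_ge_0.
move=> x hx; split; [lra|by rewrite Cmod_0; exact: Cmod_ge_0|].
move=> y hy; have -> : (c - c - 0 * (y - x) = 0)%C by ring.
rewrite Cmod_0; apply: Rmult_le_pos; [exact: Cmod_ge_0|exact: pow2_ge_0].
Qed.

Lemma sderiv_add (z : C) (s : R) (F F' G G' : C -> C) :
  sderiv z s F F' -> sderiv z s G G' ->
  sderiv z s (fun p => F p + G p)%C (fun p => F' p + G' p)%C.
Proof.
move=> [M [M0 hM]] [N [N0 hN]]; exists (M + N); split; first lra.
move=> x hx; have [a1 a2 a3] := hM x hx; have [b1 b2 b3] := hN x hx; split.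
- by have := Cmod_triangle (F x) (G x); lra.
- by have := Cmod_triangle (F' x) (G' x); lra.
- move=> y hy.
  have -> : (F y + G y - (F x + G x) - (F' x + G' x) * (y - x)
    = (F y - F x - F' x * (y - x)) + (G y - G x - G' x * (y - x)))%C by ring.
  apply: Rle_trans; first exact: Cmod_triangle.
  by have := a3 y hy; have := b3 y hy; lra.
Qed.

Lemma sderiv_mul (z : C) (s : R) (F F' G G' : C -> C) :
  sderiv z s F F' -> sderiv z s G G' ->
  sderiv z s (fun p => F p * G p)%C (fun p => F' p * G p + F p * G' p)%C.
Proof.
move=> [M [M0 hM]] hG; have [L [L0 hL]] := sderiv_lipschitz _ _ _ _ hG.
have [N [N0 hN]] := hG.
have p1 := Rmult_le_pos _ _ M0 N0; have p2 := Rmult_le_pos _ _ M0 L0.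
exists (2 * (M * N) + M * L); split; first lra.
move=> x hx; have [a1 a2 a3] := hM x hx; have [b1 b2 b3] := hN x hx.
have le (u w : C) (P Q : R) : Cmod u <= P -> Cmod w <= Q -> Cmod (u * w) <= P * Q.
  by move=> h1 h2; rewrite Cmod_mult;
     apply: Rmult_le_compat => //; exact: Cmod_ge_0.
split.
- by have := le _ _ _ _ a1 b1; lra.
- have := Cmod_triangle (F' x * G x) (F x * G' x).
  by have := le _ _ _ _ a2 b1; have := le _ _ _ _ a1 b2; lra.
- move=> y hy; have [c1 _ _] := hN y hy; have [l1 _] := hL x y hx hy.
  have -> : (F y * G y - F x * G x - (F' x * G x + F x * G' x) * (y - x)
    = (F y - F x - F' x * (y - x)) * G y + F x * (G y - G x - G' x * (y - x))
      + F' x * (y - x) * (G y - G x))%C by ring.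
  apply: Rle_trans; first exact: Cmod_triangle3.
  have d1 := le _ _ _ _ (a3 y hy) c1.
  have d2 := le _ _ _ _ a1 (b3 y hy).
  have d3 := le _ _ _ _ (le _ _ _ _ a2 (Rle_refl (Cmod (y - x)))) l1.
  have -> : (2 * (M * N) + M * L) * Cmod (y - x) ^ 2
    = M * Cmod (y - x) ^ 2 * N + M * (N * Cmod (y - x) ^ 2)
      + M * Cmod (y - x) * (L * Cmod (y - x)) by ring.
  lra.
Qed.

Lemma sderiv_comp (z w : C) (s r : R) (f f' P P' : C -> C) :
  (forall x, Cmod (x - z) < s -> Cmod (f x - w) < r) ->
  sderiv z s f f' -> sderiv w r P P' ->
  sderiv z s (fun p => P (f p)) (fun p => P' (f p) * f' p)%C.
Proof.
move=> hr hf [N [N0 hN]]; have [L [L0 hL]] := sderiv_lipschitz _ _ _ _ hf.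
have [M [M0 hM]] := hf.
have p1 := Rmult_le_pos _ _ M0 N0.
have p2 := Rmult_le_pos _ _ N0 (Rmult_le_pos _ _ L0 L0).
exists (N + M * N + N * (L * L)); split; first lra.
move=> x hx; have [a1 a2 a3] := hM x hx; have [b1 b2 b3] := hN _ (hr x hx).
split.
- lra.
- rewrite Cmod_mult.
  have := Rmult_le_compat _ _ _ _ (Cmod_ge_0 _) (Cmod_ge_0 _) b2 a2; lra.
- move=> y hy; have [l1 _] := hL x y hx hy.
  have -> : (P (f y) - P (f x) - P' (f x) * f' x * (y - x)
    = (P (f y) - P (f x) - P' (f x) * (f y - f x))
      + P' (f x) * (f y - f x - f' x * (y - x)))%C by ring.
  apply: Rle_trans; first exact: Cmod_triangle.
  rewrite Cmod_mult.
  have d1 := b3 _ (hr y hy).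
  have d2 := Rmult_le_compat _ _ _ _ (Cmod_ge_0 _) (Cmod_ge_0 _) b2 (a3 y hy).
  have d3 : Cmod (f y - f x) ^ 2 <= (L * Cmod (y - x)) ^ 2.
    by apply: pow_incr; split; [exact: Cmod_ge_0|].
  have d4 := Rmult_le_compat_l _ _ _ N0 d3.
  have d5 := Rmult_le_pos _ _ N0 (pow2_ge_0 (Cmod (y - x))).
  have -> : (N + M * N + N * (L * L)) * Cmod (y - x) ^ 2
    = N * Cmod (y - x) ^ 2 + N * (M * Cmod (y - x) ^ 2)
      + N * (L * Cmod (y - x)) ^ 2 by ring.
  lra.
Qed.

(** The disc stays at distance at least [s] from [b], so [/ s] bounds the function, and the Taylor
    remainder is exactly [(y - x)^2 / ((y - b) (x - b)^2)]. *)
Lemma sderiv_inv (z b : C) (s : R) :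
  0 < s -> 2 * s <= Cmod (z - b) ->
  sderiv z s (fun p => / (p - b))%C (fun p => - (/ (p - b) * / (p - b)))%C.
Proof.
move=> s0 hb.
have hp x : Cmod (x - z) < s -> s <= Cmod (x - b) /\ (x - b <> 0)%C.
  move=> hx; have h1 : s <= Cmod (x - b).
    have := Cmod_triangle (z - x) (x - b).
    have -> : (z - x + (x - b) = z - b)%C by ring.
    by rewrite (Cmod_minus_sym z x); lra.
  by split => // h; rewrite h Cmod_0 in h1; lra.
have hi x : Cmod (x - z) < s -> Cmod (/ (x - b))%C <= / s.
  move=> /hp [h1 h2]; rewrite Cmod_inv //.
  by apply: Rinv_le_contravar.
have i0 : 0 <= / s by left; apply: Rinv_0_lt_compat.
have i2 := Rmult_le_pos _ _ i0 i0.
have i3 := Rmult_le_pos _ _ i0 i2.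
exists (/ s + / s * / s + / s * (/ s * / s)); split; first lra.
have le (u w : C) (P Q : R) : Cmod u <= P -> Cmod w <= Q -> Cmod (u * w) <= P * Q.
  by move=> h1 h2; rewrite Cmod_mult;
     apply: Rmult_le_compat => //; exact: Cmod_ge_0.
move=> x hx; have h1 := hi x hx; have h2 := le _ _ _ _ h1 h1; split.
- lra.
- by rewrite Cmod_opp; lra.
- move=> y hy.
  have [_ nx] := hp x hx; have [_ ny] := hp y hy.
  have -> : (/ (y - b) - / (x - b) - - (/ (x - b) * / (x - b)) * (y - x)
    = / (y - b) * (/ (x - b) * / (x - b)) * ((y - x) * (y - x)))%C by field.
  rewrite Cmod_mult (Cmod_mult (y - x)).
  have h3 := le _ _ _ _ (hi y hy) h2.
  have k2 := pow2_ge_0 (Cmod (y - x)).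
  have -> : Cmod (y - x) * Cmod (y - x) = Cmod (y - x) ^ 2 by ring.
  apply: Rmult_le_compat_r => //; lra.
Qed.

Lemma holo_const (z c : C) (s : R) : holo z s (fun _ => c).
Proof. by eexists; exact: sderiv_const. Qed.

Lemma holo_add (z : C) (s : R) (F G : C -> C) :
  holo z s F -> holo z s G -> holo z s (fun p => F p + G p)%C.
Proof. by move=> [F' hF] [G' hG]; eexists; apply: sderiv_add hF hG. Qed.

Lemma holo_mul (z : C) (s : R) (F G : C -> C) :
  holo z s F -> holo z s G -> holo z s (fun p => F p * G p)%C.
Proof. by move=> [F' hF] [G' hG]; eexists; apply: sderiv_mul hF hG. Qed.

(** * Integration along segments and primitives on a disc *)

Lemma is_RInt_Cmult (c : C) (f : R -> C) (a b : R) (l : C) :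
  @is_RInt CR f a b l -> @is_RInt CR (fun t => c * f t)%C a b (c * l)%C.
Proof.
move=> h.
(* The integral is that of a real normed module, whose linearity covers real scalars only; a complex
   factor is treated through real and imaginary parts. *)
have h1 := @is_RInt_fct_extend_fst R_NormedModule R_NormedModule f a b l h.
have h2 := @is_RInt_fct_extend_snd R_NormedModule R_NormedModule f a b l h.
apply: (@is_RInt_fct_extend_pair R_NormedModule R_NormedModule) => /=.
  apply: (@is_RInt_minus R_NormedModule);
  by apply: (@is_RInt_scal R_NormedModule).
apply: (@is_RInt_plus R_NormedModule); by apply: (@is_RInt_scal R_NormedModule).
Qed.

Lemma is_derive_segment (z h : C) (t : R) :
  @is_derive R_AbsRing CR (fun t => z + RtoC t * h)%C t h.
Proof.
have h1 : @is_derive R_AbsRing CR (fun t => scal t h) t (scal 1 h).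
  exact: (@is_derive_scal_l R_AbsRing CR (fun t : R => t) t 1 h (@is_derive_id _ t)).
have h2 := @is_derive_plus R_AbsRing CR _ _ _ _ _ (@is_derive_const _ CR z t) h1.
have e : plus zero (scal 1 h) = h :> C.
  by rewrite scal_CR; change plus with Cplus; change zero with (RtoC 0); ring.
rewrite e in h2; apply: is_derive_ext h2 => s.
by rewrite scal_CR.
Qed.

Lemma continuous_lipschitz_comp (z : C) (s L : R) (F : C -> C) (g : R -> C) (t : R) :
  (forall x y, Cmod (x - z) < s -> Cmod (y - z) < s ->
      Cmod (F y - F x) <= L * Cmod (y - x)) ->
  Cmod (g t - z) < s -> @continuous _ C_UniformSpace g t ->
  @continuous _ C_UniformSpace (fun t => F (g t)) t.
Proof.
move=> hL ht hg; apply: (@continuous_comp _ C_UniformSpace C_UniformSpace) => //.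
move=> P /locally_Cmod [e [e0 he]]; apply/locally_Cmod.
have L1 : 0 < Rabs L + 1 by have := Rabs_pos L; lra.
have e1 : 0 < e / (Rabs L + 1) by apply: Rdiv_lt_0_compat.
have s1 : 0 < s - Cmod (g t - z) by lra.
exists (Rmin (s - Cmod (g t - z)) (e / (Rabs L + 1))); split; first exact: Rmin_pos.
move=> y hy; apply: he.
have h1 := Rlt_le_trans _ _ _ hy (Rmin_l _ _).
have h2 := Rlt_le_trans _ _ _ hy (Rmin_r _ _).
have hy' : Cmod (y - z) < s.
  have -> : (y - z = (y - g t) + (g t - z))%C by ring.
  by have := Cmod_triangle (y - g t) (g t - z); lra.
apply: Rle_lt_trans (hL _ _ ht hy') _.
have k0 := Cmod_ge_0 (y - g t).
apply: Rle_lt_trans (_ : (Rabs L + 1) * Cmod (y - g t) < _).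
  by apply: Rmult_le_compat_r => //; have := Rle_abs L; lra.
apply: Rlt_le_trans (_ : (Rabs L + 1) * (e / (Rabs L + 1)) <= _).
  exact: Rmult_lt_compat_l.
by apply: Req_le; field; lra.
Qed.

Lemma in_disc_segment (z h : C) (s t : R) :
  0 <= t <= 1 -> Cmod h < s -> Cmod (z + RtoC t * h - z)%C < s.
Proof.
move=> ht hh; have -> : (z + RtoC t * h - z = RtoC t * h)%C by ring.
rewrite Cmod_mult Cmod_R Rabs_pos_eq; last lra.
have := Cmod_ge_0 h; nra.
Qed.

Lemma continuous_Cmult_r (g : R -> C) (c : C) (t : R) :
  @continuous _ C_UniformSpace g t ->
  @continuous _ C_UniformSpace (fun t => g t * c)%C t.
Proof.
(* Multiplication by [c] is Lipschitz everywhere, so any disc about [g t] will do; this form of the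
   radius makes it evident that the centre belongs to the disc. *)
move=> hg; have s0 : 0 < Cmod (g t - g t) + 1 by have := Cmod_ge_0 (g t - g t); lra.
apply: (@continuous_lipschitz_comp (g t) (Cmod (g t - g t) + 1) (Cmod c)
  (fun w => w * c)%C g t) => //; last lra.
move=> x y _ _; have -> : (y * c - x * c = c * (y - x))%C by ring.
by rewrite Cmod_mult; lra.
Qed.

(* On a disc, the primitive is the integral over the segments from the
   centre; its derivative is found from d(t F(z + t h))/dt = F + t h F'. *)
Lemma holo_primitive (z : C) (s : R) (F : C -> C) :
  holo z s F -> exists H N, 0 <= N /\
    forall x y, Cmod (x - z) < s -> Cmod (y - z) < s ->
      Cmod (H y - H x - F x * (y - x)) <= N * Cmod (y - x) ^ 2.
Proof.
move=> [F' hF]; have [L [L0 hL]] := sderiv_lipschitz _ _ _ _ hF.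
have [M [M0 hM]] := hF.
have cseg h t : @continuous _ C_UniformSpace (fun t => z + RtoC t * h)%C t.
  apply: (@ex_derive_continuous R_AbsRing CR).
  by eexists; exact: is_derive_segment.
have cF h t : 0 <= t <= 1 -> Cmod h < s ->
    @continuous _ C_UniformSpace (fun t => F (z + RtoC t * h))%C t.
  move=> ht hh.
  apply: (@continuous_lipschitz_comp z s L F (fun t => z + RtoC t * h)%C t).
  - by move=> x y hx hy; have [] := hL x y hx hy.
  - exact: in_disc_segment.
  - exact: cseg.
have cF' h t : 0 <= t <= 1 -> Cmod h < s ->
    @continuous _ C_UniformSpace (fun t => F' (z + RtoC t * h))%C t.
  move=> ht hh.
  apply: (@continuous_lipschitz_comp z s L F' (fun t => z + RtoC t * h)%C t).
  - by move=> x y hx hy; have [] := hL x y hx hy.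
  - exact: in_disc_segment.
  - exact: cseg.
pose H p := @RInt C_R_CompleteNormedModule
  (fun t => F (z + RtoC t * (p - z)) * (p - z))%C 0 1.
have hH p : Cmod (p - z) < s ->
    @is_RInt CR (fun t => F (z + RtoC t * (p - z)) * (p - z))%C 0 1 (H p).
  move=> hp; apply: (@RInt_correct C_R_CompleteNormedModule).
  apply: (@ex_RInt_continuous C_R_CompleteNormedModule) => t.
  rewrite Rmin_left ?Rmax_right; try lra.
  by move=> ht; apply: continuous_Cmult_r; apply: cF.
exists H, (Rabs s * M + M); split.
  by have := Rmult_le_pos _ _ (Rabs_pos s) M0; lra.
move=> x y hx hy.
set h := (x - z)%C; set k := (y - x)%C.
have i1 := hH x hx; have i2 := hH y hy.
(* The derivative of [t * F (z + t * h) * k] is integrated over [[0, 1]]. This writes [F x * k] as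
   an integral that can be subtracted from [H y - H x] under the integral sign. *)
have i3 : @is_RInt CR (fun t => plus (scal 1 (F (z + RtoC t * h) * k)%C : CR)
    (scal t (F' (z + RtoC t * h) * h * k)%C)) 0 1
    (minus (scal 1 (F (z + RtoC 1 * h) * k)%C : CR)
           (scal 0 (F (z + RtoC 0 * h) * k)%C)).
  apply: (@is_RInt_scal_derive C_R_CompleteNormedModule (fun t => t)
    (fun t => F (z + RtoC t * h) * k)%C (fun=> 1)
    (fun t => F' (z + RtoC t * h) * h * k)%C 0 1) => t;
    rewrite Rmin_left ?Rmax_right; try lra; move=> ht.
  - exact: is_derive_id.
  - have d1 : @is_derive R_AbsRing CR (fun t => F (z + RtoC t * h))%C t
        (F' (z + RtoC t * h) * h)%C.
      apply: is_derive_taylor2 (is_derive_segment z h t).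
      by apply: sderiv_taylor2 hF _; apply: in_disc_segment.
    have q : taylor2_at (fun w => w * k)%C (F (z + RtoC t * h))%C k.
      exists 0, 1; split; try lra.
      move=> w _; set w0 := F _.
      have -> : (w * k - w0 * k - k * (w - w0) = 0)%C by ring.
      by rewrite Cmod_0; lra.
    have := is_derive_taylor2 _ _ _ _ _ q d1.
    by have -> : (k * (F' (z + RtoC t * h) * h) = F' (z + RtoC t * h) * h * k)%C by ring.
  - exact: continuous_const.
  - by do 2 apply: continuous_Cmult_r; apply: cF'.
have := @is_RInt_minus CR _ _ _ _ _ _ (@is_RInt_minus CR _ _ _ _ _ _ i2 i1) i3.
set D := fun t => _; set l := minus _ _ => iD.
have -> : (H y - H x - F x * k)%C = l.
  rewrite /l !scal_CR /h.
  have -> : (z + 1 * (x - z) = x)%C by ring.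
  change (H y - H x - F x * k
    = H y - H x - (1 * (F x * k) - 0 * (F (z + 0 * (x - z)) * k)))%C.
  ring.
have -> : (Rabs s * M + M) * Cmod k ^ 2 = (1 - 0) * ((Rabs s * M + M) * Cmod k ^ 2).
  ring.
rewrite -norm_CR; apply: (norm_RInt_le_const D) iD; first lra.
move=> t ht; rewrite norm_CR /D !scal_CR.
set xt := (z + RtoC t * h)%C.
have hxt : Cmod (xt - z) < s by apply: in_disc_segment.
set yt := (z + RtoC t * (y - z))%C.
have hyt : Cmod (yt - z) < s by apply: in_disc_segment.
have [a1 a2 a3] := hM _ hxt.
have eyx : (yt - xt = RtoC t * k)%C by rewrite /yt /xt /h /k; ring.
have b := a3 _ hyt; rewrite eyx in b.
change (Cmod (F yt * (y - z) - F xt * h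
  - (1 * (F xt * k) + RtoC t * (F' xt * h * k))) <= (Rabs s * M + M) * Cmod k ^ 2).
(* Both parts are quadratic in [k]: the first is [y - z] times the Taylor remainder of [F] at [xt]
   for the increment [t * k], the second carries [k * k]. They give the summands [Rabs s * M] and
   [M] of the constant. *)
have -> : (F yt * (y - z) - F xt * h - (1 * (F xt * k) + RtoC t * (F' xt * h * k))
  = (y - z) * (F yt - F xt - F' xt * (RtoC t * k)) + RtoC t * F' xt * (k * k))%C.
  have -> : (h = (y - z) - k)%C by rewrite /h /k; ring.
  ring.
apply: Rle_trans; first exact: Cmod_triangle.
rewrite !Cmod_mult Cmod_R in b *.
have kk := Cmod_ge_0 k.
rewrite Rabs_pos_eq in b *; try lra.
have t2 : t ^ 2 <= 1 by nra.
have k2 := pow2_ge_0 (Cmod k).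
have hs := Rle_abs s.
have b' : Cmod (F yt - F xt - F' xt * (RtoC t * k)) <= M * Cmod k ^ 2.
  apply: Rle_trans b _; apply: Rmult_le_compat_l => //.
  by rewrite Rpow_mult_distr -[X in _ <= X]Rmult_1_l; apply: Rmult_le_compat_r.
have c1 : Cmod (y - z) * Cmod (F yt - F xt - F' xt * (RtoC t * k))
    <= Rabs s * (M * Cmod k ^ 2).
  by apply: Rmult_le_compat => //; try exact: Cmod_ge_0; lra.
have c2 : t * Cmod (F' xt) <= 1 * M.
  by apply: Rmult_le_compat => //; try exact: Cmod_ge_0; lra.
have c3 : t * Cmod (F' xt) * (Cmod k * Cmod k) <= 1 * M * Cmod k ^ 2.
  have -> : Cmod k * Cmod k = Cmod k ^ 2 by ring.
  exact: Rmult_le_compat_r.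
lra.
Qed.

(** * Contour integrals *)

Lemma sderiv_ext (z : C) (s : R) (F G F' : C -> C) :
  (forall p, Cmod (p - z) < s -> F p = G p) ->
  sderiv z s F F' -> sderiv z s G F'.
Proof.
move=> e [M [M0 hM]]; exists M; split => // x hx; have [a1 a2 a3] := hM x hx.
rewrite -e //; split => // y hy; rewrite -e //; exact: a3.
Qed.

Lemma sderiv_id (z : C) (s : R) : sderiv z s (fun p => p - z)%C (fun _ => 1%C).
Proof.
have s0 := Rabs_pos s; have s1 := Rle_abs s.
exists (Rabs s + 1); split; first lra.
move=> x hx; split; [lra|rewrite Cmod_1; lra|].
move=> y hy; have -> : (y - z - (x - z) - 1 * (y - x) = 0)%C by ring.
rewrite Cmod_0; apply: Rmult_le_pos; [lra|exact: pow2_ge_0].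
Qed.

Lemma holo_inv (z b : C) :
  z <> b -> exists s, 0 < s /\ holo z s (fun p => / (p - b))%C.
Proof.
move=> zb; have h : 0 < Cmod (z - b) by apply/Cmod_gt_0; exact: Cminus_eq_contra.
exists (Cmod (z - b) / 2); split; first lra.
by eexists; apply: sderiv_inv; lra.
Qed.

(** * Local expansions at a critical point *)

Lemma psum_sderiv (a : nat -> C) (rho : R) (z : C) :
  0 < rho -> coef_bound a rho ->
  sderiv z (rho / 16) (fun p => psum a (p - z)) (fun p => psum (aderiv a) (p - z)).
Proof.
move=> hr ha; have [K1 hK1] := psum_bound _ _ ha.
have [K2 hK2] := psum_bound _ _ (coef_bound_aderiv _ _ hr ha).
have [K3 hK3] := psum_taylor2 _ _ hr ha.
exists (Rabs K1 + Rabs K2 + Rabs K3).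
have p1 := Rabs_pos K1; have p2 := Rabs_pos K2; have p3 := Rabs_pos K3.
have q1 := Rle_abs K1; have q2 := Rle_abs K2; have q3 := Rle_abs K3.
split; first lra.
move=> x hx; split.
- have := hK1 (x - z)%C; lra.
- have := hK2 (x - z)%C; lra.
- move=> y hy.
  have e : (y - x = (y - z) - (x - z))%C by ring.
  rewrite e; apply: Rle_trans (hK3 (x - z)%C (y - z)%C _ _) _; try lra.
  by apply: Rmult_le_compat_r; [exact: pow2_ge_0|lra].
Qed.

Lemma analytic_expansion (f : C -> C) (z : C) :
  analytic_at f z -> exists s d f1 q q1,
    [/\ 0 < s, sderiv z s f d, holo z s f1 & holo z s q /\ holo z s q1] /\
    forall p, Cmod (p - z) < s ->
      [/\ f p = f z + (p - z) * f1 p, d p = d z + (p - z) * q p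
        & q p = q z + (p - z) * q1 p]%C.
Proof.
move=> /analytic_at_psum [a [rho [hr ha hf]]].
have hd := coef_bound_aderiv _ _ hr ha.
have hr2 : 0 < rho / 2 by lra.
have hs := coef_bound_ashift _ _ hr ha.
have hq := coef_bound_ashift _ _ hr2 hd.
have hq1 := coef_bound_ashift _ _ hr2 hq.
have zz : (z - z = 0)%C by ring.
pose S b p := psum b (p - z).
(* The derived series has its coefficients controlled at [rho / 2], and [psum_sderiv] divides this
   by 16. Each quotient by [p - z] is the sum of a shifted series, hence regular at [z] itself. *)
exists (rho / 32), (S (aderiv a)), (S (ashift a)), (S (ashift (aderiv a))),
  (S (ashift (ashift (aderiv a)))).
have le1 : rho / 32 <= rho / 16 by lra.
have le2 : rho / 32 <= rho / 2 / 16 by lra.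
split.
  split; [lra| | |split].
  - apply: sderiv_ext (sderiv_mono _ _ _ _ _ le1 (psum_sderiv _ _ z hr ha)).
    by move=> p hp; rewrite hf //; lra.
  - by apply: holo_mono le1 _; eexists; apply: psum_sderiv.
  - by apply: holo_mono le2 _; eexists; apply: psum_sderiv.
  - by apply: holo_mono le2 _; eexists; apply: psum_sderiv.
move=> p hp; split.
- rewrite !hf /S; [|rewrite zz Cmod_0; lra|lra].
  by rewrite zz psum_0; apply: psum_ashift hr ha _; lra.
- by rewrite /S zz psum_0; apply: psum_ashift hr2 hd _; lra.
- by rewrite /S zz psum_0; apply: psum_ashift hr2 hq _; lra.
Qed.

Lemma C_derive_sderiv (z : C) (s : R) (f d : C -> C) (p : C) :
  sderiv z s f d -> Cmod (p - z) < s -> C_derive f p = d p.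
Proof. by move=> h hp; apply: C_derive_taylor2; apply: sderiv_taylor2 h hp. Qed.

Lemma analytic_critical (f P : C -> C) (z : C) :
  analytic_at f z -> analytic_at P (f z) -> C_derive f z = 0%C ->
  exists s d q q1 P1,
    [/\ 0 < s, sderiv z s f d, holo z s q & holo z s q1] /\
    [/\ holo z s (fun p => P (f p)), holo z s P1,
        q z = C_derive (C_derive f) z &
    forall p, Cmod (p - z) < s ->
      [/\ d p = (p - z) * q p, q p = q z + (p - z) * q1 p
        & P (f p) = P (f z) + (p - z) * P1 p]%C].
Proof.
move=> /analytic_expansion [s [d [f1 [q [q1 [[s0 hf hf1 [hq hq1]] hexp]]]]]].
move=> /analytic_expansion [r [dP [P1 [Q [Q1 [[r0 hP hP1 _] Pexp]]]]]] crit.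
have zz : (z - z = 0)%C by ring.
have z_in : Cmod (z - z) < s by rewrite zz Cmod_0.
have dz : d z = 0%C by rewrite -(C_derive_sderiv _ _ _ _ _ hf z_in).
have dq p : Cmod (p - z) < s -> d p = ((p - z) * q p)%C.
  by move=> hp; have [_ -> _] := hexp p hp; rewrite dz; ring.
have [L [L0 hL]] := sderiv_lipschitz _ _ _ _ hf.
have L1 : 0 < r / (L + 1) by apply: Rdiv_lt_0_compat; lra.
(* On this disc [f] takes its values in the disc about [f z] where [P] is expanded; [L + 1] avoids
   division by zero. *)
pose t := Rmin s (r / (L + 1)).
have t0 : 0 < t by apply: Rmin_pos.
have ts : t <= s by apply: Rmin_l.
have tr x : Cmod (x - z) < t -> Cmod (f x - f z) < r.
  move=> hx; have [|h _] := hL z x z_in; first lra.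
  apply: Rle_lt_trans h _.
  apply: Rle_lt_trans (_ : (L + 1) * Cmod (x - z) < _).
    by apply: Rmult_le_compat_r; [exact: Cmod_ge_0|lra].
  apply: Rlt_le_trans (_ : (L + 1) * (r / (L + 1)) <= _).
    apply: Rmult_lt_compat_l; first lra.
    by apply: Rlt_le_trans hx _; apply: Rmin_r.
  by apply: Req_le; field; lra.
(* The expansion of [P] at [f z] gives [P (f p) - P (f z) = (f p - f z) * P1 (f p)], and [f p - f z]
   is [(p - z) * f1 p]. *)
exists t, d, q, q1, (fun p => f1 p * P1 (f p))%C; split.
  split => //; [exact: sderiv_mono ts hf| |]; exact: holo_mono ts _.
have hft := sderiv_mono _ _ _ _ _ ts hf.
split.
- by eexists; apply: sderiv_comp tr hft hP.
- apply: holo_mul; first exact: holo_mono ts hf1.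
  by have [? h1] := hP1; eexists; apply: sderiv_comp tr hft h1.
(* On the disc [C_derive f] is [(p - z) * (q z + (p - z) * q1 p)], so its Taylor remainder at [z]
   with slope [q z] is [q1] times a square, and [q1] is bounded. *)
- apply: esym; apply: C_derive_taylor2.
  have [q1' hq1'] := hq1; have [M [M0 hM]] := hq1'.
  exists M, s; split => // y hy.
  rewrite (C_derive_sderiv _ _ _ _ _ hf hy) crit dq //.
  have [_ _ ->] := hexp y hy; have [h _ _] := hM y hy.
  have -> : ((y - z) * (q z + (y - z) * q1 y) - 0 - q z * (y - z)
    = q1 y * ((y - z) * (y - z)))%C by ring.
  rewrite !Cmod_mult.
  have -> : Cmod (y - z) * Cmod (y - z) = Cmod (y - z) ^ 2 by ring.
  by apply: Rmult_le_compat_r => //; exact: pow2_ge_0.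
- move=> p hp; have hps : Cmod (p - z) < s by lra.
  split; [exact: dq|by have [] := hexp p hps|].
  have [e _ _] := Pexp _ (tr p hp); rewrite e.
  have [-> _ _] := hexp p hps; ring.
Qed.

(** * Integration along piecewise smooth curves *)

Lemma curve_derive_eq (g : R -> C) (t : R) (dg : C) :
  @is_derive R_AbsRing CR g t dg -> curve_derive g t = dg.
Proof.
move=> h; rewrite /curve_derive [RHS]surjective_pairing; congr pair;
  apply: is_derive_unique.
- have h1 := @filterdiff_linear R_AbsRing CR R_NormedModule (locally (g t))
    (@fst R R) (@is_linear_fst R_AbsRing R_NormedModule R_NormedModule).
  exact: (@filterdiff_comp' R_AbsRing _ CR R_NormedModule g _ t _ _ h h1).
- have h1 := @filterdiff_linear R_AbsRing CR R_NormedModule (locally (g t))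
    (@snd R R) (@is_linear_snd R_AbsRing R_NormedModule R_NormedModule).
  exact: (@filterdiff_comp' R_AbsRing _ CR R_NormedModule g _ t _ _ h h1).
Qed.

Lemma curve_derive_ext (g h : R -> C) (t : R) :
  locally t (fun s => g s = h s) -> curve_derive g t = curve_derive h t.
Proof.
move=> e; congr pair; apply: Derive_ext_loc; apply: filter_imp e => s /= -> //.
Qed.

Lemma piecewise_C1_lt (g : R -> C) (a b : R) : piecewise_C1 g a b -> a < b.
Proof. by elim=> // {}b c _ h1 h2 _; lra. Qed.

Lemma continuous_Cmult (f g : R -> C) (t : R) :
  @continuous _ C_UniformSpace f t -> @continuous _ C_UniformSpace g t ->
  @continuous _ C_UniformSpace (fun t => f t * g t)%C t.
Proof.
move=> hf hg P /locally_C hP.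
apply: (@continuous_mult R_UniformSpace C_AbsRing f g t _ _ P hP) => Q /locally_C hQ.
  exact: hf.
exact: hg.
Qed.

(* The form [G df] is [c dp / (p - z) + dH] on the punctured disc. *)
Definition pole_split (z c : C) (s : R) (f G H : C -> C) : Prop :=
  exists d E N, [/\ 0 <= N, sderiv z s f d, holo z s E,
    forall x y, Cmod (x - z) < s -> Cmod (y - z) < s ->
      Cmod (H y - H x - E x * (y - x)) <= N * Cmod (y - x) ^ 2
  & forall p, 0 < Cmod (p - z) < s -> (G p * d p = c * / (p - z) + E p)%C].

(** Subtracting [c] times the winding integrand removes the pole and leaves [E dp], of which [H] is
    a primitive. *)
Lemma segment_integral (z c : C) (s : R) (f G H : C -> C) (g : R -> C) (a b : R) :
  pole_split z c s f G H -> a < b -> (forall t, a <= t <= b -> 0 < Cmod (g t - z) < s) ->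
  C1_segment g a b ->
  @is_RInt CR (fun t => G (g t) * curve_derive (fun r => f (g r)) t
      - c * (/ (g t - z) * curve_derive g t))%C a b (H (g b) - H (g a))%C.
Proof.
move=> [d [E [N [N0 f_d E_holo H_E split_pole]]]] ab hg [h [dh [hd hc gh]]].
have ch t : @continuous _ C_UniformSpace h t.
  by apply: (@ex_derive_continuous R_AbsRing CR); exists (dh t); exact: hd.
have hin t : a <= t <= b -> Cmod (h t - z) < s.
  by move=> ht; rewrite -gh //; have := hg t ht; lra.
have [E' hE] := E_holo; have [L [L0 hL]] := sderiv_lipschitz _ _ _ _ hE.
rewrite gh ?(gh a); try lra.
apply: (@is_RInt_ext CR (fun t => E (h t) * dh t)%C).
  move=> t; rewrite Rmin_left ?Rmax_right; try lra; move=> ht.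
  have ht' : a <= t <= b by lra.
  (* At interior points [g] agrees nearby with its smooth extension [h], so the derivatives can be
     computed on [h]; the endpoints do not affect the integral. *)
  have loc : locally t (fun r => g r = h r).
    apply: (@filter_imp _ _ _ (fun r => a < r < b)) (_ : locally t _).
      by move=> r hr; apply: gh; lra.
    by apply: (open_and (fun r => a < r) (fun r => r < b));
      [exact: open_gt|exact: open_lt|].
  have locf : locally t (fun r => f (g r) = f (h r)).
    by apply: filter_imp loc => r ->.
  rewrite (curve_derive_ext _ _ _ loc) (curve_derive_ext _ _ _ locf).
  rewrite (curve_derive_eq _ _ _ (hd t)).
  have hf := sderiv_taylor2 _ _ _ _ _ f_d (hin t ht').
  rewrite (curve_derive_eq _ _ _ (is_derive_taylor2 _ _ _ _ _ hf (hd t))).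
  have := split_pole _ (hg t ht'); rewrite (gh t ht') => e.
  by rewrite Cmult_assoc e; change (E (h t) * dh t
    = (c * / (h t - z) + E (h t)) * dh t - c * (/ (h t - z) * dh t))%C; ring.
apply: (@is_RInt_derive C_R_CompleteNormedModule (fun t => H (h t))) => t;
  rewrite Rmin_left ?Rmax_right; try lra; move=> ht.
  apply: is_derive_taylor2 (hd t).
  by apply: disc_taylor2 N0 (hin t ht) _ => y hy; apply: H_E => //; exact: hin.
have cE : @continuous _ C_UniformSpace (fun t => E (h t)) t.
  apply: (@continuous_lipschitz_comp z s L E h t) => //; last exact: hin.
  by move=> x y hx hy; have [] := hL x y hx hy.
exact: continuous_Cmult.
Qed.

Lemma piecewise_integral (z c : C) (s : R) (f G H : C -> C) (g : R -> C) (a b : R) :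
  pole_split z c s f G H -> piecewise_C1 g a b ->
  (forall t, a <= t <= b -> 0 < Cmod (g t - z) < s) ->
  @is_RInt CR (fun t => G (g t) * curve_derive (fun r => f (g r)) t
      - c * (/ (g t - z) * curve_derive g t))%C a b (H (g b) - H (g a))%C.
Proof.
move=> hG; elim=> {b} [b ab gC hg|b e gab IH be gC hg].
  exact: segment_integral hG ab hg gC.
have ab := piecewise_C1_lt _ _ _ gab.
have i1 := IH (fun t ht => hg t ltac:(lra)).
have i2 := segment_integral _ _ _ _ _ _ _ _ _ hG be (fun t ht => hg t ltac:(lra)) gC.
have := @is_RInt_Chasles CR _ _ _ _ _ _ i1 i2.
by have -> : plus (H (g b) - H (g a) : CR)%C (H (g e) - H (g b))%C
  = (H (g e) - H (g a))%C :> C; first by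
  change (H (g b) - H (g a) + (H (g e) - H (g b)) = H (g e) - H (g a))%C; ring.
Qed.

(** On a closed curve the exact part integrates to zero; adding back [c] times the winding integral,
    known by hypothesis, gives the value. *)
Lemma contour_integral (z c : C) (s : R) (f G H : C -> C) (g : R -> C) :
  pole_split z c s f G H -> small_contour z s g ->
  is_image_integral f G g (2 * PI * Ci * c)%C.
Proof.
move=> hG [gC gclosed gdisc winding].
have i1 := piecewise_integral _ _ _ _ _ _ _ _ _ hG gC gdisc.
have i2 := is_RInt_Cmult c _ _ _ _ winding.
have i3 := @is_RInt_plus CR _ _ _ _ _ _ i1 i2.
rewrite /is_image_integral.
have -> : (2 * PI * Ci * c)%C = plus (H (g 1%R) - H (g 0%R) : CR)%C (c * (2 * PI * Ci))%C.
  rewrite gclosed.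
  by change (2 * PI * Ci * c = H (g 1) - H (g 1) + c * (2 * PI * Ci))%C; ring.
apply: is_RInt_ext i3 => t _.
change (G (g t) * curve_derive (fun r => f (g r)) t
  - c * (/ (g t - z) * curve_derive g t) + c * (/ (g t - z) * curve_derive g t)
  = G (g t) * curve_derive (fun r => f (g r)) t)%C.
ring.
Qed.

(** * Residues of the pulled-back form *)

Lemma pole_split_intro (z c : C) (s : R) (f d G E : C -> C) :
  sderiv z s f d -> holo z s E ->
  (forall p, 0 < Cmod (p - z) < s -> G p * d p = c * / (p - z) + E p)%C ->
  exists H, pole_split z c s f G H.
Proof.
move=> hf hE hG; have [H [N [N0 hH]]] := holo_primitive _ _ _ hE.
by exists H, d, E, N; split.
Qed.

(** The number [c] is the residue at [z] of the form [G df]. Quantifying over all radii below [eps]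
    makes the property stable under shrinking, so that finitely many residues share one radius. *)
Definition image_residue (f G : C -> C) (z c : C) : Prop :=
  exists eps, 0 < eps /\ forall e, e <= eps -> forall g, small_contour z e g ->
    is_image_integral f G g (2 * PI * Ci * c)%C.

Lemma small_contour_mono (z : C) (e1 e2 : R) (g : R -> C) :
  e1 <= e2 -> small_contour z e1 g -> small_contour z e2 g.
Proof.
move=> h [h1 h2 h3 h4]; split => // t ht; have := h3 t ht; lra.
Qed.

Lemma image_residue_intro (z c : C) (s : R) (f d G E : C -> C) :
  0 < s -> sderiv z s f d -> holo z s E ->
  (forall p, 0 < Cmod (p - z) < s -> G p * d p = c * / (p - z) + E p)%C ->
  image_residue f G z c.
Proof.
move=> s0 hf hE hG; have [H hH] := pole_split_intro _ _ _ _ _ _ _ hf hE hG.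
exists s; split => // e es g hg.
by apply: contour_integral hH _; apply: small_contour_mono hg.
Qed.

Lemma punctured_neq (z p : C) : 0 < Cmod (p - z) -> (p - z <> 0)%C.
Proof. by move=> h /(congr1 Cmod); rewrite Cmod_0; lra. Qed.

Lemma residue_no_pole (f P : C -> C) (z a b : C) :
  analytic_at f z -> analytic_at P (f z) -> C_derive f z = 0%C ->
  z <> a -> z <> b ->
  image_residue f (fun p => / (p - a) * / (p - b) * P (f p))%C z 0.
Proof.
move=> hf hP crit /holo_inv [s1 [s10 h1]] /holo_inv [s2 [s20 h2]].
have [s [d [q [q1 [P1 [[s0 fd hq hq1] [hPf hP1 q_eq hexp]]]]]]] :=
  analytic_critical _ _ _ hf hP crit.
pose t := Rmin s (Rmin s1 s2).
have t0 : 0 < t by do 2 apply: Rmin_pos => //.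
have ts : t <= s by apply: Rmin_l.
have ts1 : t <= s1 by apply: Rle_trans (Rmin_r _ _) (Rmin_l _ _).
have ts2 : t <= s2 by apply: Rle_trans (Rmin_r _ _) (Rmin_r _ _).
apply: (@image_residue_intro z 0 t f d _
  (fun p => / (p - a) * / (p - b) * P (f p) * ((p - z) * q p))%C t0).
- exact: sderiv_mono ts fd.
- apply: holo_mul; first (apply: holo_mul; first apply: holo_mul).
  + exact: holo_mono ts1 h1.
  + exact: holo_mono ts2 h2.
  + exact: holo_mono ts hPf.
  + apply: holo_mul (holo_mono _ _ _ _ ts hq); eexists; exact: sderiv_id.
- by move=> p hp; have [-> _ _] := hexp p ltac:(lra); ring.
Qed.

Lemma residue_cancelled_pole (f P : C -> C) (z b : C) :
  analytic_at f z -> analytic_at P (f z) -> C_derive f z = 0%C ->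
  z <> b ->
  image_residue f (fun p => / (p - z) * / (p - b) * P (f p))%C z 0.
Proof.
move=> hf hP crit /holo_inv [s2 [s20 h2]].
have [s [d [q [q1 [P1 [[s0 fd hq hq1] [hPf hP1 q_eq hexp]]]]]]] :=
  analytic_critical _ _ _ hf hP crit.
pose t := Rmin s s2.
have t0 : 0 < t by apply: Rmin_pos.
have ts : t <= s by apply: Rmin_l.
have ts2 : t <= s2 by apply: Rmin_r.
(* The factor [p - z] of the derivative cancels the pole, and the regular part is the whole form. *)
apply: (@image_residue_intro z 0 t f d _ (fun p => / (p - b) * P (f p) * q p)%C t0).
- exact: sderiv_mono ts fd.
- apply: holo_mul; first apply: holo_mul.
  + exact: holo_mono ts2 h2.
  + exact: holo_mono ts hPf.
  + exact: holo_mono ts hq.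
- move=> p hp; have [-> _ _] := hexp p ltac:(lra).
  have nz := punctured_neq z p ltac:(lra).
  by set w := (/ (p - b))%C; field.
Qed.

Lemma residue_double_pole (f P : C -> C) (z : C) :
  analytic_at f z -> analytic_at P (f z) -> C_derive f z = 0%C ->
  image_residue f (fun p => / (p - z) * / (p - z) * P (f p))%C z
    (P (f z) * C_derive (C_derive f) z)%C.
Proof.
move=> hf hP crit.
have [s [d [q [q1 [P1 [[s0 fd hq hq1] [hPf hP1 <- hexp]]]]]]] :=
  analytic_critical _ _ _ hf hP crit.
(* The simple zero of the derivative reduces the form to [q p * P (f p) / (p - z)]. Expanding first
   [q] and then [P (f p)] about [z] splits off the residue [q z * P (f z)] and leaves this regular
   part. *)
apply: (@image_residue_intro z _ s f d _
  (fun p => q1 p * P (f p) + q z * P1 p)%C s0 fd).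
- apply: holo_add; apply: holo_mul => //; exact: holo_const.
- move=> p hp; have [-> qe Pe] := hexp p ltac:(lra).
  have nz := punctured_neq z p ltac:(lra).
  rewrite qe; set w := P (f p) in Pe *.
  have -> : ((/ (p - z) * / (p - z) * w * ((p - z) * (q z + (p - z) * q1 p)))
    = q z * / (p - z) * w + q1 p * w)%C by field.
  by rewrite {1}Pe; field.
Qed.

(** * Restriction to a coordinate axis *)

HB.instance Definition _ := Monoid.isComLaw.Build C (RtoC 0) Cplus
  Cplus_assoc Cplus_comm Cplus_0_l.

HB.instance Definition _ := Monoid.isComLaw.Build C (RtoC 1) Cmult
  Cmult_assoc Cmult_comm Cmult_1_l.

Lemma sum_n_big (F : nat -> C) (N : nat) :
  @sum_n C_AbelianMonoid F N = \big[Cplus/RtoC 0]_(m < N.+1) F m.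
Proof.
elim: N => [|N IH]; first by rewrite sum_O big_ord_recr big_ord0 /= Cplus_0_l.
by rewrite sum_Sn IH [RHS]big_ord_recr.
Qed.

Definition axis_index (n N : nat) (m : 'I_N.+1) : {ffun option 'I_n -> 'I_N.+1} :=
  [ffun o => if o is None then m else ord0].

Definition axis_coef (n : nat) (c : {ffun option 'I_n -> nat} -> C) (m : nat) : C :=
  c [ffun o => if o is None then m else 0%nat].

Definition axis_point (n : nat) (h : C) (o : option 'I_n) : C :=
  if o is None then h else 0%C.

Lemma mterm_axis (n N : nat) (c : {ffun option 'I_n -> nat} -> C) (h : C)
    (m : 'I_N.+1) :
  mterm c (axis_point n h) (axis_index n N m) = powser (axis_coef n c) h m.
Proof.
rewrite /mterm /powser /axis_coef Cmult_comm; congr Cmult.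
  rewrite (bigD1 None) //= big1 => [|[i|] //= _]; last by rewrite ffunE.
  by rewrite ffunE /= Cmult_1_r Cpower_Cpow.
by congr c; apply/ffunP => -[i|]; rewrite !ffunE.
Qed.

Lemma mterm_off_axis (n N : nat) (c : {ffun option 'I_n -> nat} -> C) (h : C)
    (a : {ffun option 'I_n -> 'I_N.+1}) :
  axis_index n N (a None) != a -> mterm c (axis_point n h) a = 0%C.
Proof.
move=> ha; have [i hi] : exists i, a (Some i) != ord0.
  apply/existsP; apply: contraNT ha => /existsPn h0; apply/eqP/ffunP => -[i|];
    rewrite ffunE //.
  by apply/esym/eqP; have := h0 i; rewrite negbK.
rewrite /mterm (bigD1 (Some i)) //=.
have -> : Cpower 0 (a (Some i)) = 0%C.
  rewrite Cpower_Cpow; case E: (nat_of_ord (a (Some i))) hi => [|k].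
    by move=> /eqP []; apply: val_inj.
  by move=> _; rewrite /= Cmult_0_l.
by rewrite Cmult_0_l Cmult_0_r.
Qed.

(** For an increment along the [p]-axis, a monomial with a positive exponent in another variable
    vanishes, while [0 ^ 0 = 1] leaves the others. The partial sums over boxes of multi-indices thus
    become ordinary partial sums in one variable. *)
Lemma manalytic_slice (n : nat) (f : C -> ('I_n -> C) -> C) (z : C)
    (u : 'I_n -> C) :
  manalytic_at (joint f) (joint_point z u) -> analytic_at (fun p => f p u) z.
Proof.
move=> [c [r [r0 hc]]]; exists (axis_coef n c), r; split => // h hh.
have [|_] := hc (axis_point n h).
  by case=> [i|] //=; rewrite Cmod_0.
have -> : joint f (fun o => joint_point z u o + axis_point n h o)%C = f (z + h)%C u.
  rewrite /joint /=; congr f; apply: functional_extensionality => i.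
  by rewrite Cplus_0_r.
move=> hl; apply/is_pseries_powser; apply: filterlim_ext hl => N.
rewrite [RHS]sum_n_big.
pose axis_part (a : {ffun option 'I_n -> 'I_N.+1}) := a None.
(* The predicate singles out the multi-indices on the axis, which are then reindexed by their [None]
   entry. *)
rewrite (bigID (fun a => axis_index n N (axis_part a) == a)) /=.
rewrite [X in (_ + X)%C]big1 ?Cplus_0_r; last by move=> a; exact: mterm_off_axis.
rewrite (reindex_onto (axis_index n N) axis_part) /=; last first.
  by move=> a /eqP.
apply: eq_big => [m|m _]; last exact: mterm_axis.
by rewrite /axis_part !ffunE !eqxx.
Qed.

(** * A common radius and the quadratic expansion *)

Lemma uniform_radius (T : finType) (P : T -> R -> Prop) :
  (forall x, exists eps, 0 < eps /\ forall e, e <= eps -> P x e) ->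
  exists eps, 0 < eps /\ forall x, P x eps.
Proof.
move=> h.
have [eps [e0 he]] : exists eps, 0 < eps /\
    forall x, x \in enum T -> forall e, e <= eps -> P x e.
  elim: (enum T) => [|x s [e1 [e10 h1]]]; first by exists 1; split => //; lra.
  have [e2 [e20 h2]] := h x.
  exists (Rmin e1 e2); split; first exact: Rmin_pos.
  move=> y; rewrite inE => /orP [/eqP ->|ys] e he.
    by apply: h2; apply: Rle_trans he (Rmin_r _ _).
  by apply: h1 ys _ _; apply: Rle_trans he (Rmin_l _ _).
by exists eps; split => // x; apply: he (Rle_refl _); rewrite mem_enum.
Qed.

Local Open Scope C_scope.

Theorem theorem2 (n : nat) (U : ('I_n -> C) -> Prop)
    (A : nat -> ('I_n -> C) -> C) (v : 'I_n -> ('I_n -> C) -> C)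
    (Dom : C -> ('I_n -> C) -> Prop) (lam : C -> ('I_n -> C) -> C)
    (phi : 'I_n -> C -> C) (u : 'I_n -> C)
    (Hred : benney_reduction U A v)
    (Hlam : lambda_function U A v Dom lam)
    (Hu : U u)
    (Hphi : forall k : 'I_n, analytic_at (phi k) (u k)) :
  exists eps : R, (0 < eps)%R /\
    forall gamma : 'I_n -> R -> C,
      (forall k : 'I_n, small_contour (v k u) eps (gamma k)) ->
      exists J : 'I_n -> 'I_n -> 'I_n -> C,
        (forall i j k : 'I_n,
           is_image_integral (fun p => lam p u)
             (fun p => W v u i p * W v u j p * phi k (lam p u))
             (gamma k) (J i j k))
        /\ forall i j : 'I_n,
             g_contra lam v phi i u * kronecker i j
               = phi i (u i) * lambda'' lam (v i u) u * kronecker i j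
             /\ phi i (u i) * lambda'' lam (v i u) u * kronecker i j
               = / (2 * PI * Ci) * \big[Cplus/RtoC 0]_(k < n) J i j k.
Proof.
have f_an k : analytic_at (fun p => lam p u) (v k u).
  apply: manalytic_slice; apply: (lam_analytic Hlam).
  exact: (lam_dom_velocity Hlam).
have crit k := lam_critical_point Hlam k Hu.
have val k : lam (v k u) u = u k := lam_critical_value Hlam k Hu.
have P_an k : analytic_at (phi k) (lam (v k u) u) by rewrite val.
have neq i k : i != k -> v k u <> v i u.
  by move=> ik e; apply: (red_distinct Hred Hu (i := k) (j := i)) e => ki;
     rewrite ki eqxx in ik.
pose c i j k := if (i == k) && (j == k) then phi k (u k) * lambda'' lam (v k u) u
  else RtoC 0.
(* Indexing by triples puts all the integrals in one finite type, so a single radius serves every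
   [i], [j] and [k]. *)
have res (x : 'I_n * 'I_n * 'I_n) : image_residue (fun p => lam p u)
    (fun p => W v u x.1.1 p * W v u x.1.2 p * phi x.2 (lam p u)) (v x.2 u)
    (c x.1.1 x.1.2 x.2).
  case: x => -[i j] k; rewrite /c /W /=.
  have [->|ik] := eqVneq i k; have [->|jk] := eqVneq j k => /=.
  - rewrite -val; exact: residue_double_pole.
  - apply: residue_cancelled_pole => //; exact: neq.
  (* Here the pole comes from the second factor, so the two factors are exchanged. *)
  - have := residue_cancelled_pole _ _ _ (v i u) (f_an k) (P_an k)
      (crit k) (neq _ _ ik).
    by congr image_residue; apply: functional_extensionality => p;
      rewrite (Cmult_comm (/ (p - v k u))).
  - by apply: residue_no_pole => //; exact: neq.
have [eps [eps0 heps]] := uniform_radius _ _ res.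
exists eps; split => // gamma hgamma.
(* The values depend only on the residues and not on the contours [gamma]. *)
exists (fun i j k => 2 * PI * Ci * c i j k); split.
  by move=> i j k; exact: (heps (i, j, k)).
move=> i j; split => //.
have pi0 : 2 * PI * Ci <> 0.
  have two : RtoC 2 <> 0 by move=> /RtoC_inj; lra.
  have hpi : RtoC PI <> 0 by move=> /RtoC_inj; have := PI_RGT_0; lra.
  have hCi : Ci <> 0 by move=> /(congr1 snd) /=; lra.
  exact: Cmult_neq_0 (Cmult_neq_0 _ _ two hpi) hCi.
(* Only [k = i] can contribute, and its residue is nonzero only if [j = i], which produces the
   Kronecker symbol. *)
rewrite (bigD1 i) //= big1 => [|k /negPf ki].
  rewrite /c eqxx /kronecker (eq_sym j).
  by set w := (2 * PI * Ci) in pi0 *; case: eqP => _ /=; field.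
by rewrite /c (eq_sym i) ki /= Cmult_0_r.
Qed.
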